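(* Let $r>0$, $\rho>0$, and consider the circle of radius $r$ centered at the origin in $\mathbb{R}^2$. For $T>0$ small, let $\alpha$ points be uniformly distributed with density $\rho$ (number of points per unit arc length) on an arc of this circle subtending an angle $2T$ at the center, so that $\alpha = 2rT\rho$. Let $\sigma_1>\sigma_2$ be the two singular values of the data on the arc. Put $\kappa = 1/r$ and $M=\dfrac{\alpha}{2\sqrt{15}\,\rho}\in\mathbb{R}^+$. Then $\sigma_2/\sigma_1\approx M\kappa$ for small $T$, in the sense that, with $r$ and $\rho$ fixed, $$\lim_{T\to 0^+}\frac{\sigma_2/\sigma_1}{M\kappa}=1 .$$
   Context: The data on the arc is modelled by the uniform distribution on the arc: after a rotation about the origin (which does not affect the singular values), a data point is $(x_1,x_2)=(r\cos t,\, r\sin t)$ with $t$ uniformly distributed on $[-T,T]$. Let $\mu_{x_i}=\frac{1}{2T}\int_{-T}^{T}x_i(t)\,dt$, and let $\Sigma$ be the $2\times 2$ covariance matrix with entries $\mathrm{cov}(x_i,x_j)=\frac{1}{2T}\int_{-T}^{T}(x_i(t)-\mu_{x_i})(x_j(t)-\mu_{x_j})\,dt$, $i,j\in\{1,2\}$. The singular values of the data are those associated with its principal components. That is, if $\lambda_1>\lambda_2$ are the eigenvalues of $\Sigma$, then $\sigma_i=\sqrt{\lambda_i}$ up to a common positive scaling factor, so $\sigma_2/\sigma_1=\sqrt{\lambda_2/\lambda_1}$. The number of points $\alpha$ is treated as the real quantity $\alpha=\rho\cdot 2rT$ (density times arc length). $\kappa=1/r$ is the curvature of the circle. *)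

(* Defs.v *)
(* MathComp / MathComp-Analysis; the reals are an arbitrary [R : realType]. *)
From HB Require Import structures.
From mathcomp Require Import all_boot all_order all_algebra.
From mathcomp Require Import all_classical all_reals all_analysis.

Set Implicit Arguments.
Unset Strict Implicit.
Unset Printing Implicit Defensive.

Import Order.TTheory GRing.Theory Num.Theory.
Import numFieldNormedType.Exports.

Local Open Scope classical_set_scope.
Local Open Scope ring_scope.

(* The arc of half-angle T centred at direction theta is {arc_coord r theta _ t
   | t in [-T, T]}; theta = 0 is the position reached after a rotation about
   the origin. *)
Definition arc_coord (R : realType) (r theta : R) (i : 'I_2) (t : R) : R :=
  if i == ord0 then r * cos (theta + t) else r * sin (theta + t).

(* Only meaningful for 0 < T. *)
Definition unif_mean (R : realType) (T : R) (f : R -> R) : R :=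
  (2 * T)^-1 * \int[lebesgue_measure]_(t in `[- T, T]) f t.

Definition unif_cov (R : realType) (T : R) (f g : R -> R) : R :=
  unif_mean T (fun t => (f t - unif_mean T f) * (g t - unif_mean T g)).

Definition arc_covmx (R : realType) (r theta T : R) : 'M[R]_2 :=
  \matrix_(i, j) unif_cov T (arc_coord r theta i) (arc_coord r theta j).

(* Singular values are only fixed up to a common positive factor c, which may
   depend on r, theta and T. Two distinct eigenvalues exhaust the spectrum of a
   2 x 2 matrix. *)
Definition arc_singular_values (R : realType) (r theta T s1 s2 : R) : Prop :=
  exists l1 l2 c : R,
    [/\ eigenvalue (arc_covmx r theta T) l1,
        eigenvalue (arc_covmx r theta T) l2,
        l2 < l1,
        0 < c &
        s1 = c * Num.sqrt l1 /\ s2 = c * Num.sqrt l2].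

(* Density times arc length, a real number that need not be an integer. *)
Definition arc_npoints (R : realType) (r rho T : R) : R := rho * (2 * r * T).

Definition arc_M (R : realType) (r rho T : R) : R :=
  arc_npoints r rho T / (2 * Num.sqrt 15 * rho).

Definition circle_curvature (R : realType) (r : R) : R := 1 / r.

(* Main.v *)
Require Import Defs.
From HB Require Import structures.
From mathcomp Require Import all_boot all_order all_algebra.
From mathcomp Require Import all_classical all_reals all_analysis.
From mathcomp Require Import ring lra.
Import Order.TTheory GRing.Theory Num.Theory.
Import numFieldNormedType.Exports.
Local Open Scope classical_set_scope.
Local Open Scope ring_scope.

(** Turning the arc so that it is centred on the first axis conjugates the
    covariance matrix by a rotation and, by the symmetry of [-T, T], makes it
    diagonal: for every theta its eigenvalues are r^2 times the variances of
    cos t and of sin t for t uniform on [-T, T] (eigenvalue_arc_covmx).  The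
    sine is the tangential direction and the cosine the radial one.  For small
    t, sin t is about t and cos t about 1 - t^2/2, so

      Var(sin t) ~ E[t^2] = T^2/3,
      Var(cos t) ~ Var(t^2)/4 = (T^4/5 - T^4/9)/4 = T^4/45.

    Hence the tangential eigenvalue is the larger one, which settles which
    eigenvalue is l1 and which is l2, and sigma2/sigma1 behaves like
    sqrt((T^4/45)/(T^2/3)) = T/sqrt 15.  On the other side,
    M * kappa = (2 r T rho)/(2 sqrt 15 rho) * (1/r) is exactly T/sqrt 15.

    Both variances have closed forms in sin T and cos T, in which the leading
    terms cancel: the variance of the cosine only appears at the sixth order of
    the numerator.  The two asymptotic equivalences are therefore derived from
    the alternating Taylor bounds of sine and cosine, up to order 7 and 8
    (sin_cos_poly_alternate), and give an error of relative order T^2, explicit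
    for every T > 0 (var_sin_bounds, var_cos_bounds). *)

Set Implicit Arguments.
Unset Strict Implicit.

(** * Alternating Taylor bounds of sine and cosine *)

Definition sin_poly (R : realType) (n : nat) : {poly R} :=
  \sum_(k < n) ((-1) ^+ k / (k.*2.+1)`!%:R) *: 'X^(k.*2.+1).

Definition cos_poly (R : realType) (n : nat) : {poly R} :=
  \sum_(k < n) ((-1) ^+ k / (k.*2)`!%:R) *: 'X^(k.*2).

Lemma deriv_sin_poly (R : realType) n : (sin_poly R n)^`() = cos_poly R n.
Proof.
rewrite raddf_sum /=; apply: eq_bigr => k _.
rewrite derivZ derivXn -scalerMnr scalerMnl; congr (_ *: _).
rewrite -mulr_natr factS natrM invfM.
by rewrite mulrA mulrAC divfK // pnatr_eq0.
Qed.

Lemma deriv_cos_poly (R : realType) n :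
  (cos_poly R n.+1)^`() = - sin_poly R n.
Proof.
rewrite raddf_sum /= big_ord_recl /= derivZ derivXn mulr0n scaler0 add0r -sumrN.
apply: eq_bigr => k _; rewrite derivZ derivXn -scalerMnr scalerMnl -scaleNr /=.
congr (_ *: _); rewrite -mulr_natr /bump /= add1n doubleS factS natrM invfM.
by rewrite exprS mulrA mulrAC divfK ?pnatr_eq0 // mulN1r mulNr.
Qed.

Lemma is_derive_continuous (R : realType) (f df : R -> R) :
  (forall x : R, is_derive x 1 f (df x)) -> continuous f.
Proof.
move=> fdf x; apply/differentiable_continuous/derivable1_diffP.
by have := fdf x; case.
Qed.

Lemma ge0_derive_ge0 (R : realType) (f df : R -> R) :
  (forall x : R, is_derive x 1 f (df x)) -> f 0 = 0 ->
  (forall x : R, 0 <= x -> 0 <= df x) -> forall x : R, 0 <= x -> 0 <= f x.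
Proof.
move=> fdf f0 df0 x x0; rewrite -f0.
apply: (@ger0_derive1_ndecry _ f 0) => // [y|].
- rewrite in_itv /= andbT => /ltW y0.
  by rewrite derive1E (@derive_val _ _ _ _ _ _ _ (fdf y)) df0.
- exact/continuous_subspaceT/(is_derive_continuous fdf).
Qed.

(** Successive Taylor polynomials over- and underestimate in turn on the
    nonnegative half-line.  Up to sign, the derivative of each remainder is the
    previous remainder, and all of them vanish at 0; so the sign propagates by
    monotonicity, from the cosine to the sine of the same rank and from there to
    the cosine of the next rank, starting from cos x <= 1. *)
Lemma sin_cos_poly_alternate (R : realType) n (x : R) : 0 <= x ->
  0 <= (-1) ^+ n.+1 * (cos x - (cos_poly R n.+1).[x]) /\
  0 <= (-1) ^+ n.+1 * (sin x - (sin_poly R n.+1).[x]).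
Proof.
have sin_step m : (forall x, 0 <= x ->
      0 <= (-1) ^+ m.+1 * (cos x - (cos_poly R m.+1).[x])) ->
    forall x, 0 <= x -> 0 <= (-1) ^+ m.+1 * (sin x - (sin_poly R m.+1).[x]).
  apply: ge0_derive_ge0 => [y|].
    by rewrite -deriv_sin_poly; apply: is_deriveZ.
  rewrite sin0 sub0r horner_sum big1 ?oppr0 ?mulr0 // => k _.
  by rewrite hornerZ hornerXn expr0n /= mulr0.
have cos_step m : (forall x, 0 <= x ->
      0 <= (-1) ^+ m.+1 * (sin x - (sin_poly R m.+1).[x])) ->
    forall x, 0 <= x -> 0 <= (-1) ^+ m.+2 * (cos x - (cos_poly R m.+2).[x]).
  apply: ge0_derive_ge0 => [y|].
    have -> : (-1) ^+ m.+1 * (sin y - (sin_poly R m.+1).[y]) =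
        (-1) ^+ m.+2 * (- sin y - (cos_poly R m.+2)^`().[y]).
      by rewrite deriv_cos_poly hornerN [in RHS]exprS; ring.
    exact: is_deriveZ.
  rewrite cos0 horner_sum big_ord_recl /= hornerZ hornerXn.
  rewrite big1 ?addr0; first by rewrite !expr0 fact0 divr1 mulr1 subrr mulr0.
  by move=> k _; rewrite hornerZ hornerXn /bump /= add1n expr0n /= mulr0.
have cosP m : forall x, 0 <= x ->
    0 <= (-1) ^+ m.+1 * (cos x - (cos_poly R m.+1).[x]).
  elim: m => [y _|m IH]; last exact/cos_step/sin_step.
  rewrite /cos_poly big_ord_recl big_ord0 /= addr0 hornerZ hornerXn.
  by have := cos_le1 y; rewrite expr1 !expr0 fact0; lra.
by move=> x0; split; [exact: cosP | apply: sin_step => //; exact: cosP].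
Qed.

Lemma sin_bounds (R : realType) (u : R) : 0 <= u ->
  [/\ u - u ^+ 3 / 6 <= sin u,
      sin u <= u - u ^+ 3 / 6 + u ^+ 5 / 120 &
      u - u ^+ 3 / 6 + u ^+ 5 / 120 - u ^+ 7 / (42 * 120) <= sin u].
Proof.
move=> u0.
(* 42 * 120 is 7!, kept as a product because numerals are unary. *)
have fE : ((0.*2.+1)`! = 1)%N * ((1.*2.+1)`! = 6)%N * ((2.*2.+1)`! = 120)%N *
  ((3.*2.+1)`! = 42 * 120)%N by [].
have dE : (0.*2 = 0)%N * (1.*2 = 2)%N * (2.*2 = 4)%N * (3.*2 = 6)%N by [].
have [_] := sin_cos_poly_alternate 1 u0.
have [_] := sin_cos_poly_alternate 2 u0.
have [_] := sin_cos_poly_alternate 3 u0.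
rewrite /sin_poly !big_ord_recr !big_ord0 /= !fE (natrM _ 42 120).
rewrite !(hornerD, hornerZ, hornerXn) !horner0 !dE.
by move=> ? ? ?; split; lra.
Qed.

Lemma cos_bounds (R : realType) (u : R) : 0 <= u ->
  1 - u ^+ 2 / 2 + u ^+ 4 / 24 - u ^+ 6 / 720 <= cos u
    <= 1 - u ^+ 2 / 2 + u ^+ 4 / 24 - u ^+ 6 / 720 + u ^+ 8 / (56 * 720).
Proof.
move=> u0.
(* 56 * 720 is 8!. *)
have fE : ((0.*2)`! = 1)%N * ((1.*2)`! = 2)%N * ((2.*2)`! = 24)%N *
  ((3.*2)`! = 720)%N * ((4.*2)`! = 56 * 720)%N by [].
have dE : (0.*2 = 0)%N * (1.*2 = 2)%N * (2.*2 = 4)%N * (3.*2 = 6)%N *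
  (4.*2 = 8)%N by [].
have [+ _] := sin_cos_poly_alternate 3 u0.
have [+ _] := sin_cos_poly_alternate 4 u0.
rewrite /cos_poly !big_ord_recr !big_ord0 /= !fE (natrM _ 56 720).
rewrite !(hornerD, hornerZ, hornerXn) !horner0 !dE.
by move=> ? ?; apply/andP; split; lra.
Qed.

(** * Moments of the uniform distribution on an arc *)

Lemma unif_mean_primitive (R : realType) (f F : R -> R) (T : R) : 0 < T ->
  (forall x : R, is_derive x 1 F (f x)) -> continuous f ->
  unif_mean T f = (F T - F (- T)) / (2 * T).
Proof.
move=> T0 Ff cf; rewrite /unif_mean mulrC; congr (_ / _).
have cF := is_derive_continuous Ff.
rewrite /Rintegral (@continuous_FTC2 _ f F) //; first by rewrite gtrN.
- exact: continuous_subspaceT.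
- split=> [x _||]; first by have := Ff x; case.
  + exact/cvg_at_right_filter/cF.
  + exact/cvg_at_left_filter/cF.
- by move=> x _; rewrite derive1E (@derive_val _ _ _ _ _ _ _ (Ff x)).
Qed.

(** The variances of cos t and of sin t for t uniform on [-T, T], in closed
    form.  The mean of the sine is 0, that of the cosine is sin T / T. *)
Definition var_cos (R : realType) (T : R) : R :=
  1 / 2 + sin T * cos T / (2 * T) - (sin T / T) ^+ 2.

Definition var_sin (R : realType) (T : R) : R :=
  1 / 2 - sin T * cos T / (2 * T).

Lemma unif_mean_cos_sin (R : realType) (p q T : R) : 0 < T ->
  unif_mean T (fun t => p * cos t + q * sin t) = p * (sin T / T).
Proof.
move=> T0.
have D (x : R) : is_derive x 1 (fun t => p * sin t - q * cos t)
    (p * cos x + q * sin x).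
  apply: is_derive_eq.
  rewrite /GRing.scale /=.
  ring.
have C : continuous (fun t : R => p * cos t + q * sin t).
  apply: is_derive_continuous.
rewrite (unif_mean_primitive T0 D C) sinN cosN.
by field; rewrite gt_eqF.
Qed.

(** By bilinearity of the covariance; there is no mixed term because cos and
    sin are uncorrelated on an interval symmetric about 0. *)
Lemma unif_cov_cos_sin (R : realType) (p q p' q' T : R) : 0 < T ->
  unif_cov T (fun t => p * cos t + q * sin t) (fun t => p' * cos t + q' * sin t)
    = p * p' * var_cos T + q * q' * var_sin T.
Proof.
move=> T0; rewrite /unif_cov !unif_mean_cos_sin //.
set m := sin T / T.
have D (x : R) : is_derive x 1 (fun t =>
   (p * p' * (t + sin t * cos t) / 2 + q * q' * (t - sin t * cos t) / 2
    + (p * q' + q * p') * (sin t ^+ 2) / 2)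
   - m * (p * p' * 2 * sin t - (p * q' + q * p') * cos t)
   + p * p' * m ^+ 2 * t)
   ((p * cos x + q * sin x - p * m) * (p' * cos x + q' * sin x - p' * m)).
  apply: is_derive_eq.
  (* The primitive was chosen with cos^2 = (1 + cos^2 - sin^2)/2 and the
     analogous form of sin^2, so the two sides differ by a multiple of
     1 - cos^2 - sin^2. *)
  rewrite /GRing.scale /=; apply/eqP; rewrite -subr_eq0; apply/eqP.
  transitivity ((p * p' + q * q') / 2 * (1 - (cos x ^+ 2 + sin x ^+ 2))).
    by field.
  by rewrite cos2Dsin2 subrr mulr0.
have C : continuous (fun x : R =>
   (p * cos x + q * sin x - p * m) * (p' * cos x + q' * sin x - p' * m)).
  apply: is_derive_continuous.
rewrite (unif_mean_primitive T0 D C) sinN cosN.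
by rewrite /var_cos /var_sin /m; field; rewrite gt_eqF.
Qed.

(** * Spectrum of the covariance matrix *)

Lemma eigenvalue_mx22 (F : fieldType) (A : 'M[F]_2) (l : F) :
  eigenvalue A l = ((l - A 0 0) * (l - A 1 1) - A 0 1 * A 1 0 == 0).
Proof.
rewrite eigenvalue_root_char /root /char_poly.
rewrite (expand_det_row _ ord0) !big_ord_recl big_ord0 /cofactor.
rewrite !det_mx11 !mxE /=.
have -> : lift (lift ord0 ord0) 0 = 0 :> 'I_2 by apply/val_inj.
have -> : lift ord0 0 = 1 :> 'I_2 by apply/val_inj.
rewrite !(hornerD, hornerN, hornerM, hornerX, hornerC, mulr1n, mulr0n) /=.
by congr (_ == _); ring.
Qed.

(** The angle-sum formulas write the coordinates as combinations of cos t and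
    sin t whose coefficient vectors are orthogonal and of length r, so the
    covariance matrix is r^2 diag(var_cos T, var_sin T) conjugated by the
    rotation of angle theta. *)
Lemma eigenvalue_arc_covmx (R : realType) (r theta T l : R) : 0 < T ->
  eigenvalue (arc_covmx r theta T) l =
  (l == r ^+ 2 * var_cos T) || (l == r ^+ 2 * var_sin T).
Proof.
move=> T0.
have xE : arc_coord r theta 0 =
    (fun t => (r * cos theta) * cos t + (- (r * sin theta)) * sin t).
  by apply/funext => t; rewrite /arc_coord /= cosD; ring.
have yE : arc_coord r theta 1 =
    (fun t => (r * sin theta) * cos t + (r * cos theta) * sin t).
  by apply/funext => t; rewrite /arc_coord /= sinD; ring.
rewrite eigenvalue_mx22 !mxE xE yE !unif_cov_cos_sin //.
rewrite -[in RHS]subr_eq0 -[X in _ || X]subr_eq0 -mulf_eq0.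
congr (_ == _).
have -> : r ^+ 2 = r ^+ 2 * (cos theta ^+ 2 + sin theta ^+ 2).
  by rewrite cos2Dsin2 mulr1.
ring.
Qed.

(** * Asymptotics of the two variances *)

(** After doubling the angle, var_sin T / T^2 = (u - sin u) / (4 T^3) with
    u = 2T, and the Taylor bounds of order 3 and 5 apply. *)
Lemma var_sin_bounds (R : realType) (T : R) : 0 < T ->
  1 / 3 - T ^+ 2 / 15 <= var_sin T / T ^+ 2 <= 1 / 3.
Proof.
move=> T0; have [sl su _] := sin_bounds (u := T *+ 2) ltac:(lra).
have -> : var_sin T / T ^+ 2 = (T *+ 2 - sin (T *+ 2)) / (4 * T ^+ 3).
  by rewrite sin_mulr2n /var_sin; field; rewrite gt_eqF.
have T3 : 0 < 4 * T ^+ 3 by rewrite mulr_gt0 // exprn_gt0.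
rewrite ler_pdivlMr // ler_pdivrMr //; apply/andP; split.
  have -> : (1 / 3 - T ^+ 2 / 15) * (4 * T ^+ 3) = T *+ 2 -
    (T *+ 2 - (T *+ 2) ^+ 3 / 6 + (T *+ 2) ^+ 5 / 120) by field.
  lra.
have -> : 1 / 3 * (4 * T ^+ 3) = T *+ 2 - (T *+ 2 - (T *+ 2) ^+ 3 / 6) by field.
lra.
Qed.

(** With u = 2T, T^2 var_cos T = u^2/8 + u (sin u)/8 - (1 - cos u)/2.  The terms
    in u^2 and u^4 cancel and the one in u^6 is u^6/2880 = T^6/45, so sine is
    needed up to u^7 and cosine up to u^8. *)
Lemma var_cos_bounds (R : realType) (T : R) : 0 < T ->
  1 / 45 - T ^+ 2 * 2 / 315 <= var_cos T / T ^+ 4 <= 1 / 45 + T ^+ 2 / 315.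
Proof.
move=> T0; have u0 : 0 <= T *+ 2 by lra.
have [_ su sl] := sin_bounds u0.
have /andP[cl cu] := cos_bounds u0.
have -> : var_cos T / T ^+ 4 =
    (T ^+ 2 / 2 + T * sin (T *+ 2) / 4 - (1 - cos (T *+ 2)) / 2) / T ^+ 6.
  rewrite sin_mulr2n cos_mulr2n cos2sin2 /var_cos; field; by rewrite gt_eqF.
have T6 : 0 < T ^+ 6 by rewrite exprn_gt0.
have Tsl := ler_wpM2l (ltW T0) sl.
have Tsu := ler_wpM2l (ltW T0) su.
rewrite ler_pdivlMr // ler_pdivrMr //; apply/andP; split; lra.
Qed.

Lemma var_cos_gt0 (R : realType) (T : R) : 0 < T < 1 -> 0 < var_cos T.
Proof.
move=> /andP[T0 T1]; have /andP[+ _] := var_cos_bounds T0.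
have T2 : T ^+ 2 < 1 by rewrite expr_lt1 // ltW.
move=> h; have : 0 < var_cos T / T ^+ 4 by lra.
by rewrite pmulr_lgt0 // invr_gt0 exprn_gt0.
Qed.

Lemma var_cos_lt_sin (R : realType) (T : R) :
  0 < T < 1 -> var_cos T < var_sin T.
Proof.
move=> /andP[T0 T1]; have /andP[_ +] := var_cos_bounds T0.
have /andP[+ _] := var_sin_bounds T0.
have T20 : 0 < T ^+ 2 by rewrite exprn_gt0.
have T2 : T ^+ 2 < 1 by rewrite expr_lt1 // ltW.
rewrite ler_pdivlMr // ler_pdivrMr ?exprn_gt0 //.
rewrite (_ : T ^+ 4 = T ^+ 2 * T ^+ 2); last by ring.
move: (T ^+ 2) T20 T2 => x x0 x1; nra.
Qed.

Lemma near0_lt1 (R : realType) : \forall T \near (0 : R)^'+, 0 < T < 1.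
Proof.
near=> T; apply/andP; split; first by near: T; exact: nbhs_right_gt.
by near: T; apply: nbhs_right_lt.
Unshelve. all: by end_near. Qed.

Lemma cvg_at_right0_affine (R : realType) (a b : R) :
  a + b * T ^+ 2 @[T --> (0 : R)^'+] --> a.
Proof.
have {2}-> : a = a + b * 0 ^+ 2 by rewrite expr0n mulr0 addr0.
apply: cvg_at_right_filter; apply: cvgD; first exact: cvg_cst.
by apply: cvgMr; apply: exprn_continuous.
Qed.

Lemma cvg_var_sin (R : realType) :
  var_sin T / T ^+ 2 @[T --> (0 : R)^'+] --> (1 / 3 : R).
Proof.
apply: (@squeeze_cvgr _ _ _ _ (fun T => 1 / 3 + (- (1 / 15)) * T ^+ 2)
  (fun T => 1 / 3 + 0 * T ^+ 2)); try exact: cvg_at_right0_affine.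
near=> T; have /var_sin_bounds/andP[? ?] : 0 < T.
  by near: T; exact: nbhs_right_gt.
by apply/andP; split; lra.
Unshelve. all: by end_near. Qed.

Lemma cvg_var_cos (R : realType) :
  var_cos T / T ^+ 4 @[T --> (0 : R)^'+] --> (1 / 45 : R).
Proof.
apply: (@squeeze_cvgr _ _ _ _ (fun T => 1 / 45 + (- (2 / 315)) * T ^+ 2)
  (fun T => 1 / 45 + (1 / 315) * T ^+ 2)); try exact: cvg_at_right0_affine.
near=> T; have /var_cos_bounds/andP[? ?] : 0 < T.
  by near: T; exact: nbhs_right_gt.
by apply/andP; split; lra.
Unshelve. all: by end_near. Qed.

(** * Singular values of the arc *)

(** The ordering var_cos T < var_sin T forces l1 to be the eigenvalue of the
    tangential direction; the scaling factor c and the radius r then cancel. *)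
Lemma arc_singular_ratio (R : realType) (r theta T s1 s2 : R) :
  0 < r -> 0 < T < 1 -> arc_singular_values r theta T s1 s2 ->
  s2 / s1 = Num.sqrt (var_cos T / var_sin T).
Proof.
move=> r0 T01 [l1 [l2 [c [+ + + c0 [-> ->]]]]].
have /andP[T0 _] := T01.
have cs := var_cos_lt_sin T01; have vc0 := var_cos_gt0 T01.
have r2 : 0 < r ^+ 2 by rewrite exprn_gt0.
rewrite !eigenvalue_arc_covmx // => /orP[] /eqP-> /orP[] /eqP->;
  rewrite ?ltxx // ltr_pM2l //; first by rewrite ltNge ltW.
move=> _.
have cancel (k a b : R) : 0 < k -> (k * a) / (k * b) = a / b.
  by move=> k0; rewrite -mulf_div divff ?mul1r // gt_eqF.
rewrite cancel // !(sqrtrM _ (ltW r2)) cancel ?sqrtr_gt0 //.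
by rewrite sqrtrM ?ltW // sqrtrV // ltW // (lt_trans vc0).
Qed.

Unset Implicit Arguments.

Theorem theorem2p1 (R : realType) (r rho theta : R) (hr : 0 < r) (hrho : 0 < rho) :
  (\forall T \near (0 : R)^'+,
     exists s1 s2 : R, s2 < s1 /\ arc_singular_values r theta T s1 s2) /\
  (forall sigma1 sigma2 : R -> R,
     (\forall T \near (0 : R)^'+,
        arc_singular_values r theta T (sigma1 T) (sigma2 T)) ->
     (sigma2 T / sigma1 T) / (arc_M r rho T * circle_curvature r)
       @[T --> (0 : R)^'+] --> (1 : R)).
Proof.
split.
  near=> T; have T01 : 0 < T < 1 by near: T; exact: near0_lt1.
  have /andP[T0 _] := T01.
  have r2 : 0 < r ^+ 2 by rewrite exprn_gt0.
  have l21 : r ^+ 2 * var_cos T < r ^+ 2 * var_sin T.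
    by rewrite ltr_pM2l // var_cos_lt_sin.
  exists (1 * Num.sqrt (r ^+ 2 * var_sin T)).
  exists (1 * Num.sqrt (r ^+ 2 * var_cos T)); split.
    rewrite !mul1r ltr_sqrt // (lt_trans _ l21) // mulr_gt0 //.
    exact: var_cos_gt0.
  exists (r ^+ 2 * var_sin T), (r ^+ 2 * var_cos T), 1.
  by rewrite !eigenvalue_arc_covmx // !eqxx orbT.
move=> sigma1 sigma2 sv.
(* The factor 15 absorbs the 1/sqrt 15 of M, and each variance is divided by
   its own power of T, which leaves the limit 15 * (1/45) / (1/3) = 1. *)
have lim : Num.sqrt (15 * ((var_cos T / T ^+ 4) * (var_sin T / T ^+ 2)^-1))
    @[T --> (0 : R)^'+] --> (1 : R).
  have E : Num.sqrt (15 * (1 / 45 * (1 / 3)^-1)) = 1 :> R.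
    by rewrite (_ : 15 * _ = 1) ?sqrtr1 //; field.
  rewrite -[X in _ --> X]E.
  apply: continuous_cvg; first exact: sqrt_continuous.
  apply: cvgMl_tmp; apply: cvgM; first exact: cvg_var_cos.
  apply: cvgV; [by apply/eqP; lra | exact: cvg_var_sin].
apply: cvg_trans lim; apply: near_eq_cvg.
near=> T; have T01 : 0 < T < 1 by near: T; exact: near0_lt1.
have /(arc_singular_ratio hr T01) -> :
  arc_singular_values r theta T (sigma1 T) (sigma2 T) by near: T.
have /andP[T0 _] := T01.
have cs := var_cos_lt_sin T01; have vc0 := var_cos_gt0 T01.
have vs0 := lt_trans vc0 cs.
have -> : arc_M r rho T * circle_curvature r = T / Num.sqrt 15.
  rewrite /arc_M /arc_npoints /circle_curvature; field.
  by rewrite !gt_eqF ?sqrtr_gt0.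
have {1}-> : 15 * (var_cos T / T ^+ 4 / (var_sin T / T ^+ 2)) =
   (var_cos T / var_sin T) * (15 / T ^+ 2).
  by field; rewrite !gt_eqF.
have -> : T / Num.sqrt 15 = (Num.sqrt (15 / T ^+ 2))^-1.
  rewrite sqrtrM // sqrtrV ?exprn_ge0 ?ltW // sqrtr_sqr gtr0_norm //.
  by rewrite invf_div.
by rewrite invrK sqrtrM // divr_ge0 // ltW.
Unshelve. all: by end_near. Qed.
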